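(* In the doubly Gaussian DAG-probit model described in the context, with flat prior $f(\theta)\propto1$ on the cut-off $\theta\in\mathbb{R}$, the posterior of $\theta$ with the latent vectors $\boldsymbol{X}_1^{(1)},\boldsymbol{X}_1^{(2)}$ integrated out satisfies, up to a factor not depending on $\theta$, $$f\left(\theta\mid\boldsymbol{y}^{(1)},\boldsymbol{y}^{(2)},\boldsymbol{X}_{-1}^{(1)},\boldsymbol{X}_{-1}^{(2)},\boldsymbol{D},\boldsymbol{L}^{(1)},\boldsymbol{L}^{(2)},\mathcal{D}^{(1)},\mathcal{D}^{(2)}\right)\propto\prod_{k=1}^2\prod_{i=1}^{n_k}\Psi\left(y_i^{(k)},\theta\mid-\boldsymbol{x}^{(k)}_{i,\mathrm{pa}(1)}\boldsymbol{L}_1^{(k)},1\right).$$ Consequently, the Metropolis–Hastings acceptance probability for this target with proposal $\theta'\mid\theta\sim\mathcal{N}(\theta,\sigma_0^2)$, $\sigma_0^2>0$, is $\alpha_\theta=\min\{1,r_\theta\}$ with $$r_\theta=\prod_{k=1}^2\frac{\prod_{i=1}^{n_k}\Psi\left(y_i^{(k)},\theta'\mid-\boldsymbol{x}^{(k)}_{i,\mathrm{pa}(1)}\boldsymbol{L}_1^{(k)},1\right)}{\prod_{i=1}^{n_k}\Psi\left(y_i^{(k)},\theta\mid-\boldsymbol{x}^{(k)}_{i,\mathrm{pa}(1)}\boldsymbol{L}_1^{(k)},1\right)}\cdot\frac{f_{\mathcal{N}}(\theta\mid\theta',\sigma_0^2)}{f_{\mathcal{N}}(\theta'\mid\theta,\sigma_0^2)}.$$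 Here $\Psi(y,\eta\mid\mu,\sigma^2)=|y-\Phi(\eta\mid\mu,\sigma^2)|$ for $y\in\{0,1\}$, where $\Phi(\cdot\mid\mu,\sigma^2)$ is the c.d.f. of $\mathcal{N}(\mu,\sigma^2)$.
   Context: For $k=1,2$: $\mathcal{D}^{(k)}$ is a DAG on $V=\{1,\dots,q\}$ in which node $1$ has no children, $\mathrm{pa}^{(k)}(j)$ is the parent set of $j$ in $\mathcal{D}^{(k)}$, and $\boldsymbol{X}^{(k)}=(x_{i,j}^{(k)})$ is an $n_k\times q$ real matrix with columns $\boldsymbol{X}_1^{(k)},\dots,\boldsymbol{X}_q^{(k)}$. Column $\boldsymbol{X}_1^{(k)}$ is latent and $\boldsymbol{X}_{-1}^{(k)}=(\boldsymbol{X}_2^{(k)},\dots,\boldsymbol{X}_q^{(k)})$ is observed. $\boldsymbol{X}^{(k)}_{\mathrm{pa}(j)}$ is the submatrix of columns in $\mathrm{pa}^{(k)}(j)$, and $\boldsymbol{x}^{(k)}_{i,\mathrm{pa}(1)}$ is the $i$-th row of $\boldsymbol{X}^{(k)}_{\mathrm{pa}(1)}$. The observed binary responses are $\boldsymbol{y}^{(k)}=(y_1^{(k)},\dots,y_{n_k}^{(k)})\in\{0,1\}^{n_k}$, with $y_i^{(k)}=0$ if $x_{i,1}^{(k)}<\theta$ and $y_i^{(k)}=1$ if $x_{i,1}^{(k)}\ge\theta$; the cut-off $\theta$ is common to both groups. Parameters: $\boldsymbol{D}=\mathrm{diag}(\sigma_1^2,\dots,\sigma_q^2)$ with $\sigma_1^2=1$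 and $\sigma_j^2>0$, shared by both groups; and $\boldsymbol{L}^{(k)}=(\boldsymbol{L}_j^{(k)})_j$ with $\boldsymbol{L}_j^{(k)}\in\mathbb{R}^{|\mathrm{pa}^{(k)}(j)|}$. With $\theta_{-1}:=-\infty$, $\theta_0:=\theta$, $\theta_1:=\infty$, the augmented likelihood is $$f(\boldsymbol{y}^{(1)},\boldsymbol{y}^{(2)},\boldsymbol{X}^{(1)},\boldsymbol{X}^{(2)}\mid\mathcal{D}^{(1)},\mathcal{D}^{(2)},\boldsymbol{D},\boldsymbol{L}^{(1)},\boldsymbol{L}^{(2)},\theta)=\prod_{k=1}^2\left[\prod_{j=1}^q f_{\mathcal{N}_{n_k}}\big(\boldsymbol{X}_j^{(k)}\mid-\boldsymbol{X}^{(k)}_{\mathrm{pa}(j)}\boldsymbol{L}_j^{(k)},\sigma_j^2\boldsymbol{I}_{n_k}\big)\prod_{i=1}^{n_k}\mathbb{1}\big(\theta_{y_i^{(k)}-1}<x_{i,1}^{(k)}\le\theta_{y_i^{(k)}}\big)\right],$$ where $f_{\mathcal{N}_n}$ is the $n$-variate normal density with the given mean and covariance, and $f_{\mathcal{N}}(\cdot\mid\mu,\sigma^2)$ is the univariate one. The posterior of $\theta$ given the listed quantities is proportional, as a function of $\theta$, to the integral of this likelihood over $\boldsymbol{X}_1^{(1)}$ and $\boldsymbol{X}_1^{(2)}$ times $f(\theta)$. The Metropolis–Hastings acceptance probability for a target with unnormalized density $\pi$ and proposal density $q(\theta'\mid\theta)$ is $\min\{1,\pi(\theta')q(\theta\mid\theta')/(\pi(\theta)q(\theta'\mid\theta))\}$.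 *)

(* Defs.v *)
From HB Require Import structures.
From mathcomp Require Import all_boot all_order all_algebra.
From mathcomp Require Import all_classical all_reals all_analysis.

Set Implicit Arguments.
Unset Strict Implicit.
Unset Printing Implicit Defensive.

Import Order.TTheory GRing.Theory Num.Theory.
Import numFieldNormedType.Exports.

Local Open Scope classical_set_scope.
Local Open Scope ring_scope.

(* Lebesgue measure on R^n, carried by n.-tuple R: the image of
   lebesgue_measure \x (Lebesgue measure on R^n) under (x, t) |-> x :: t gives
   the one on R^n.+1, starting from the Dirac mass on the point R^0. *)
Section lebesgue_tuple_step.
Context {R : realType} (n : nat).
Variable m : {sigma_finite_measure set (n.-tuple (measurableTypeR R)) -> \bar R}.

Let cons_pair (z : measurableTypeR R * n.-tuple (measurableTypeR R)) :
  n.+1.-tuple (measurableTypeR R) := [tuple of z.1 :: z.2].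

Definition lebesgue_cons : set (n.+1.-tuple (measurableTypeR R)) -> \bar R :=
  pushforward (lebesgue_measure \x m)%E cons_pair.

Let measurable_cons_pair : measurable_fun [set: _] cons_pair.
Proof. exact: measurable_cons. Qed.

Let lebesgue_cons0 : lebesgue_cons set0 = 0%E.
Proof. by rewrite /lebesgue_cons /pushforward preimage_set0 measure0. Qed.

Let lebesgue_cons_ge0 A : (0 <= lebesgue_cons A)%E.
Proof. exact: measure_ge0. Qed.

Let lebesgue_cons_sigma_additive : semi_sigma_additive lebesgue_cons.
Proof.
move=> F mF tF mUF; rewrite /lebesgue_cons /pushforward preimage_bigcup.
apply: measure_semi_sigma_additive.
- by move=> i; rewrite -[X in measurable X]setTI; exact: measurable_cons_pair.
- apply/trivIsetP => /= i j _ _ ij; rewrite -preimage_setI.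
  by move/trivIsetP : tF => /(_ _ _ _ _ ij) ->//; rewrite preimage_set0.
- rewrite -preimage_bigcup -[X in measurable X]setTI.
  exact: measurable_cons_pair.
Qed.

HB.instance Definition _ := isMeasure.Build _ _ _ lebesgue_cons
  lebesgue_cons0 lebesgue_cons_ge0 lebesgue_cons_sigma_additive.

Let lebesgue_cons_sigma_finite : sigma_finite setT lebesgue_cons.
Proof.
pose uncons (t : n.+1.-tuple (measurableTypeR R)) :
  measurableTypeR R * n.-tuple (measurableTypeR R) :=
  (thead t, [tuple of behead t]).
have muncons : measurable_fun [set: _] uncons.
  apply: measurable_fun_pair => /=; last exact: measurable_behead.
  exact: (measurable_tnth ord0).
have consK : cancel cons_pair uncons.
  by move=> [x t]; congr pair; exact/val_inj.
have [F FT Ffin] : sigma_finite setT (lebesgue_measure \x m)%E.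
  have /sigma_finiteP[F [TF ndF Foo]] :=
    sigma_finiteT (@lebesgue_measure R : {sigma_finite_measure set _ -> \bar R}).
  have /sigma_finiteP[G [TG ndG Goo]] := sigma_finiteT m.
  exists (fun i => F i `*` G i).
    rewrite -setXTT TF TG predeqE => -[x t]; split.
      move=> [/= [i _ Fix] [j _ Gjt]]; exists (maxn i j) => //; split.
      + by move: x Fix; exact/subsetPset/ndF/leq_maxl.
      + by move: t Gjt; exact/subsetPset/ndG/leq_maxr.
    by move=> [i _ []/= ? ?]; split; exists i.
  move=> i; have [? ?] := Foo i; have [? ?] := Goo i.
  split; first exact: measurableX.
  by rewrite product_measure1E// lte_mul_pinfty// ge0_fin_numE.
exists (fun i => uncons @^-1` F i).
  by rewrite -preimage_bigcup -FT preimage_setT.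
move=> i; have [mFi Fioo] := Ffin i; split.
  by rewrite -[X in measurable X]setTI; exact: muncons.
rewrite /lebesgue_cons /pushforward -comp_preimage.
by rewrite (_ : uncons \o cons_pair = id)//; apply/funext => z; exact: consK.
Qed.

HB.instance Definition _ := Measure_isSigmaFinite.Build _ _ _ lebesgue_cons
  lebesgue_cons_sigma_finite.

End lebesgue_tuple_step.

Fixpoint lebesgue_tuple {R : realType} (n : nat) :
    {sigma_finite_measure set (n.-tuple (measurableTypeR R)) -> \bar R} :=
  match n with
  | 0 => \d_([tuple] : 0.-tuple (measurableTypeR R))
  | n'.+1 => lebesgue_cons (lebesgue_tuple n')
  end.

(* A directed graph on 'I_q is its edge relation: e u v means u -> v. *)
Definition acyclic q (e : rel 'I_q) := forall c : seq 'I_q, cycle e c -> c = [::].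

Definition parents q (e : rel 'I_q) (j : 'I_q) : {set 'I_q} := [set u | e u j].

Section model.
Context {R : realType}.

Definition cols_in n q (X : 'M[R]_(n, q)) (A : {set 'I_q}) : 'M[R]_(n, #|A|) :=
  colsub (fun i : 'I_#|A| => enum_val i) X.

Definition mvnormal_pdf n (mu : 'cV[R]_n) (Sigma : 'M[R]_n) (x : 'cV[R]_n) : R :=
  (Num.sqrt ((2 * pi) ^+ n * \det Sigma))^-1 *
  expR (- ((x - mu)^T *m invmx Sigma *m (x - mu)) ord0 ord0 / 2).

(* The univariate normal law below is parametrized by its variance v, the one
   of the library by the standard deviation. *)
Definition normal_density (mu v x : R) : R := normal_pdf mu (Num.sqrt v) x.

Definition normal_cdf (mu v x : R) : R :=
  fine (normal_prob mu (Num.sqrt v) `]-oo, x]).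

Definition Psi (y : bool) (eta mu v : R) : R :=
  `| y%:R - normal_cdf mu v eta |.

(* theta_{-1} = -oo, theta_0 = theta, theta_1 = +oo *)
Definition cutpoint (theta : R) (m : int) : \bar R :=
  if m == -1 then -oo%E else if m == 0 then theta%:E else +oo%E.

Definition in_cell (theta : R) (y : bool) (x : R) : bool :=
  ((cutpoint theta (y%:Z - 1) < x%:E) && (x%:E <= cutpoint theta y%:Z))%E.

(* The two groups are indexed by bool: false is the first group, true the
   second. Nodes are 'I_q.+1; the latent node is ord0. *)
Section likelihood.
Variables (q : nat) (n : bool -> nat).
Variable dag : bool -> rel 'I_q.+1.
Variable D : 'M[R]_q.+1.
Variable L : forall (k : bool) (j : 'I_q.+1), 'cV[R]_#|parents (dag k) j|.
Variable y : forall k : bool, 'I_(n k) -> bool.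

Definition node_mean k (X : 'M[R]_(n k, q.+1)) (j : 'I_q.+1) : 'cV[R]_(n k) :=
  - (cols_in X (parents (dag k) j) *m L k j).

Definition aug_likelihood (theta : R) (X : forall k, 'M[R]_(n k, q.+1)) : R :=
  \prod_(k : bool)
    ((\prod_(j < q.+1)
        mvnormal_pdf (node_mean (X k) j) (D j j)%:M (col j (X k))) *
     \prod_(i < n k) (in_cell theta (y i) (X k i ord0))%:R).

Definition latent_cols
    (x : (n false).-tuple (measurableTypeR R) *
         (n true).-tuple (measurableTypeR R)) (k : bool) : 'cV[R]_(n k) :=
  if k as k0 return 'cV[R]_(n k0)
  then \col_i tnth x.2 i else \col_i tnth x.1 i.

(* Likelihood with both latent columns integrated out, times the prior. *)
Definition posterior_kernel (prior : R -> R)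
    (Xobs : forall k, 'M[R]_(n k, q)) (theta : R) : \bar R :=
  ((\int[lebesgue_tuple (n false) \x lebesgue_tuple (n true)]_x
      (aug_likelihood theta
         (fun k => row_mx (latent_cols x k) (Xobs k)))%:E)
   * (prior theta)%:E)%E.

End likelihood.

Definition propto (f g : R -> \bar R) : Prop :=
  exists c : R, 0 < c /\ forall t, f t = (c%:E * g t)%E.

(* prop t' t is the proposal density of t' given the current state t. *)
Definition mh_acceptance (target : R -> R) (prop : R -> R -> R) (t t' : R) : R :=
  Num.min 1 (target t' * prop t t' / (target t * prop t' t)).

End model.

(* Main.v *)
(* Node 1 has no children, so only the factor j = 1 of the Gaussian likelihood
   involves the latent columns; the other factors form a positive constant.
   Its covariance is the identity, so it splits over the rows, and by Tonelli the
   marginal likelihood is a product of one-dimensional integrals of the density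
   of N(mu, 1) over ]-oo, theta] (y = 0) or ]theta, +oo[ (y = 1), each equal to
   Psi(y, theta | mu, 1). The constant cancels in the Metropolis-Hastings
   ratio. *)

Require Import Defs.
From mathcomp Require Import all_boot all_order all_algebra.
From mathcomp Require Import all_classical all_reals all_analysis.
From mathcomp Require Import measurable_realfun.

Import Order.TTheory GRing.Theory Num.Theory.
Import numFieldNormedType.Exports.

Local Open Scope classical_set_scope.
Local Open Scope ring_scope.

(** * Gaussian densities *)

Lemma normal_density_gt0 (R : realType) (mu v x : R) :
  0 < v -> 0 < normal_density mu v x.
Proof.
move=> v0; have s0 : Num.sqrt v != 0 by rewrite gt_eqF// sqrtr_gt0.
rewrite /normal_density normal_pdfE// mulr_gt0 ?expR_gt0//.
exact: normal_peak_gt0.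
Qed.

(** The determinant of [v%:M] is [v ^+ n] and its inverse turns the quadratic form into a sum of
    squares over [v], so the constant and the exponential both factor over the coordinates. *)
Lemma mvnormal_pdf_scalar (R : realType) (n : nat) (mu : 'cV[R]_n) (v : R)
    (x : 'cV[R]_n) : 0 < v ->
  mvnormal_pdf mu v%:M x =
  \prod_(i < n) normal_density (mu i ord0) v (x i ord0).
Proof.
move=> v0; have s0 : Num.sqrt v != 0 by rewrite gt_eqF// sqrtr_gt0.
(* The normalizing constant is the root of an [n]-th power on the left, an [n]-th power of roots on
   the right. *)
have sqrtX (a : R) : 0 <= a -> Num.sqrt (a ^+ n) = Num.sqrt a ^+ n.
  move=> a0; elim: n {mu x} => [|m IHm]; first by rewrite !expr0 sqrtr1.
  by rewrite !exprS sqrtrM// IHm.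
rewrite /normal_density.
under eq_bigr do
  rewrite normal_pdfE// /normal_peak /normal_fun sqr_sqrtr ?ltW//.
rewrite big_split/= prodr_const card_ord exprVn -expR_sum /mvnormal_pdf.
congr (_ * _).
  rewrite det_scalar -exprMn sqrtX ?mulr_ge0 ?pi_ge0 1?ltW//.
  by rewrite mulrAC -mulrA mulr_natl -mulrnAl mulrC.
congr expR; rewrite invmx_scalar -mulmxA mul_scalar_mx -scalemxAr !mxE.
rewrite -mulrN mulrAC -sumrN mulr_sumr; apply: eq_bigr => i _; rewrite !mxE.
rewrite -[v *+ 2]mulr_natr invfM expr2 !mulNr mulrN; congr (- _).
exact: mulrC.
Qed.

(** * Tonelli for products of functions of separate variables *)

Lemma ge0_integral_prodM (d1 d2 : measure_display) (T1 : measurableType d1)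
    (T2 : measurableType d2) (R : realType)
    (m1 : {sigma_finite_measure set T1 -> \bar R})
    (m2 : {sigma_finite_measure set T2 -> \bar R})
    (f : T1 -> R) (g : T2 -> R) (a b : R) :
  measurable_fun setT f -> measurable_fun setT g ->
  (forall x, 0 <= f x) -> (forall x, 0 <= g x) ->
  (\int[m1]_x (f x)%:E)%E = a%:E -> (\int[m2]_x (g x)%:E)%E = b%:E ->
  (\int[m1 \x m2]_z (f z.1 * g z.2)%:E)%E = (a * b)%:E.
Proof.
move=> mf mg f0 g0 fa gb; rewrite fubini_tonelli1/=; first last.
- by move=> z; rewrite lee_fin mulr_ge0.
- apply/measurable_EFinP/measurable_funM.
  + by apply: (measurableT_comp mf); exact: measurable_fst.
  + by apply: (measurableT_comp mg); exact: measurable_snd.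
(* The inner integral is [f x * b]; the sign of [b] lets it leave the outer one. *)
have b0 : (0 <= b%:E)%E by rewrite -gb integral_ge0// => x _; rewrite lee_fin.
rewrite /fubini_F/=; under eq_integral => x _.
  under eq_integral do rewrite EFinM.
  rewrite ge0_integralZl//=; first last.
  - by rewrite lee_fin.
  - by move=> t _; rewrite lee_fin.
  - exact/measurable_EFinP.
  rewrite gb muleC.
over.
rewrite ge0_integralZl//=.
- by rewrite fa -EFinM mulrC.
- exact/measurable_EFinP.
- by move=> x _; rewrite lee_fin.
Qed.

Lemma measurable_tuple_prod (R : realType) (n : nat) (g : 'I_n -> R -> R) :
  (forall i, measurable_fun setT (g i)) ->
  measurable_fun setT
    (fun x : n.-tuple (measurableTypeR R) => \prod_(i < n) g i (tnth x i)).
Proof.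
move=> mg; apply: measurable_prod => i _.
exact: (measurableT_comp (mg i) (measurable_tnth i)).
Qed.

(** Induction along the construction of [lebesgue_tuple]: the Dirac mass gives the empty product,
    and a change of variables along [cons] separates the head from the tail. *)
Lemma ge0_integral_lebesgue_tuple_prod (R : realType) (n : nat)
    (g : 'I_n -> R -> R) (a : 'I_n -> R) :
  (forall i, measurable_fun setT (g i)) -> (forall i x, 0 <= g i x) ->
  (forall i, (\int[lebesgue_measure]_x (g i x)%:E)%E = (a i)%:E) ->
  (\int[lebesgue_tuple n]_x (\prod_(i < n) g i (tnth x i))%:E)%E =
  (\prod_(i < n) a i)%:E.
Proof.
elim: n g a => [|n IHn] g a mg g0 ga /=.
  rewrite integral_dirac//=; last first.
    by apply/measurable_EFinP; exact: measurable_tuple_prod.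
  by rewrite diracT mul1e !big_ord0.
rewrite ge0_integral_pushforward//=; first last.
- by move=> x _; rewrite lee_fin prodr_ge0.
- by apply/measurable_EFinP; exact: measurable_tuple_prod.
- by apply: measurable_cons; [exact: measurable_fst|exact: measurable_snd].
rewrite preimage_setT big_ord_recl.
under eq_integral => z _.
  rewrite /= big_ord_recl tnth0; under eq_bigr do rewrite tnthS.
  over.
rewrite /=.
apply: (ge0_integral_prodM _ _ _ _ _ lebesgue_measure (lebesgue_tuple n)
  (g ord0) (fun t : n.-tuple (measurableTypeR R) =>
    \prod_(i < n) g (lift ord0 i) (tnth t i)) _ _) => //.
- exact: mg.
- apply: (measurable_tuple_prod _ n (fun i => g (lift ord0 i))) => i.
  exact: mg.
- by move=> x; rewrite prodr_ge0.
- apply: (IHn (fun i => g (lift ord0 i)) (fun i => a (lift ord0 i))) => i.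
  + exact: mg.
  + exact: g0.
  + exact: ga.
Qed.

(** * Response cells and [Psi] *)

Lemma in_cell0 (R : realType) (theta x : R) :
  in_cell theta false x = (x <= theta).
Proof. by rewrite /in_cell /cutpoint /= ltNyr lee_fin. Qed.

Lemma in_cell1 (R : realType) (theta x : R) :
  in_cell theta true x = (theta < x).
Proof. by rewrite /in_cell /cutpoint /= leey andbT lte_fin. Qed.

(** Makes the cell constraint the indicator of a measurable interval, ready for integration. *)
Lemma in_cell_itv (R : realType) (theta : R) (y : bool) (x : R) :
  in_cell theta y x =
  (x \in if y then `]theta, +oo[%classic else `]-oo, theta]%classic).
Proof.
case: y; rewrite ?in_cell0 ?in_cell1;
  by apply/idP/idP; rewrite inE/= in_itv/= ?andbT.
Qed.

Lemma measurable_cell_itv (R : realType) (theta : R) (y : bool) :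
  measurable
    (if y then `]theta, +oo[%classic else `]-oo, theta]%classic : set R).
Proof. by case: y. Qed.

Lemma measurable_normal_cell (R : realType) (mu v theta : R) (y : bool) :
  measurable_fun setT
    (fun x => normal_density mu v x * (in_cell theta y x)%:R).
Proof.
apply: measurable_funM; first exact: measurable_normal_pdf.
under eq_fun do rewrite in_cell_itv -indicE.
by apply: measurable_indic; exact: measurable_cell_itv.
Qed.

(** The indicator restricts the density to the cell, leaving the normal probability of an interval.
    Since the c.d.f. lies between 0 and 1, the absolute value in [Psi] is the c.d.f. for response 0
    and its complement to 1 for response 1. *)
Lemma integral_normal_cell (R : realType) (mu v theta : R) (y : bool) :
  (\int[lebesgue_measure]_x
     (normal_density mu v x * (in_cell theta y x)%:R)%:E)%E =
  (Psi y theta mu v)%:E.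
Proof.
have fin : forall A : set R, measurable A ->
    normal_prob mu (Num.sqrt v) A \is a fin_num.
  by move=> A mA; exact: fin_num_measure.
transitivity (normal_prob mu (Num.sqrt v)
    (if y then `]theta, +oo[%classic else `]-oo, theta]%classic)).
  rewrite /normal_prob [RHS]integral_mkcond; apply: eq_integral => x _.
  rewrite patchE in_cell_itv /normal_density.
  by case: (x \in _); rewrite ?mulr1 ?mulr0.
rewrite /Psi /normal_cdf; case: y => /=.
  rewrite -setCitvl (probability_setC (normal_prob mu (Num.sqrt v)))//.
  rewrite -[X in (1 - X)%E](fineK (fin _ _))// ger0_norm// subr_ge0.
  by rewrite -lee_fin fineK ?fin// probability_le1.
rewrite sub0r normrN ger0_norm ?fineK ?fin//.
by rewrite fine_ge0.
Qed.

(** * Substituting the latent column *)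

Section row_mx_col'.
Variables (R : realType) (m q : nat) (c : 'cV[R]_m) (M : 'M[R]_(m, q.+1)).
(** [M] with its latent column replaced by [c], as in the integrand of [posterior_kernel]. *)
Let Z : 'M[R]_(m, q.+1) := row_mx c (col' ord0 M).

Lemma row_mx_col'0 i : Z i ord0 = c i ord0.
Proof.
(* Columns of [row_mx] are indexed by ['I_(1 + q)]; the two forms of the index agree by value. *)
rewrite -[in RHS](row_mxEl c (col' ord0 M)).
by congr (Z i _); exact/val_inj.
Qed.

Lemma row_mx_col'_neq0 i j : j != ord0 -> Z i j = M i j.
Proof.
rewrite eq_sym => /unlift_some[j' -> _].
transitivity (col' ord0 M i j'); last by rewrite mxE.
rewrite -[in RHS](row_mxEr c (col' ord0 M)).
by congr (Z i _); exact/val_inj.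
Qed.

End row_mx_col'.

Lemma eq_cols_in (R : realType) (m q : nat) (M N : 'M[R]_(m, q))
    (A : {set 'I_q}) :
  (forall i j, j \in A -> M i j = N i j) -> cols_in M A = cols_in N A.
Proof.
move=> MN; apply/matrixP => i j; rewrite [LHS]mxE [RHS]mxE.
by apply: MN; exact: enum_valP.
Qed.

(** * The marginal likelihood *)

Section marginal.
Variables (R : realType) (q : nat) (n : bool -> nat).
Variable dag : bool -> rel 'I_q.+1.
Hypothesis latent_childless : forall k j, ~~ dag k ord0 j.
Variable D : 'M[R]_q.+1.
Hypothesis D_pos : forall j, 0 < D j j.
Variable L : forall (k : bool) (j : 'I_q.+1), 'cV[R]_#|parents (dag k) j|.
Variable y : forall k : bool, 'I_(n k) -> bool.
Variable X : forall k : bool, 'M[R]_(n k, q.+1).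

Local Notation latent_mean k i := (node_mean L (X k) ord0 i ord0).

(** The constant of proportionality: as [ord0] is a parent of no node, it depends on the observed
    columns only, and not on the cut-off. *)
Definition observed_density : R :=
  \prod_(k : bool) \prod_(j < q.+1 | j != ord0)
    mvnormal_pdf (node_mean L (X k) j) (D j j)%:M (col j (X k)).

Lemma observed_density_gt0 : 0 < observed_density.
Proof.
apply: prodr_gt0 => k _; apply: prodr_gt0 => j _.
rewrite mvnormal_pdf_scalar//; apply: prodr_gt0 => i _.
exact: normal_density_gt0.
Qed.

(** The one-dimensional integrand of row [i]. Its mean is read off [X], since the parents of [ord0]
    are observed. *)
Definition latent_density theta k (i : 'I_(n k)) (x : R) : R :=
  normal_density (latent_mean k i) (D ord0 ord0) x *
  (in_cell theta (y k i) x)%:R.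

Lemma aug_likelihood_latent theta (Z : forall k, 'M[R]_(n k, q.+1)) :
  (forall k i j, j != ord0 -> Z k i j = X k i j) ->
  aug_likelihood D L y theta Z =
  observed_density *
  \prod_(k : bool) \prod_(i < n k) latent_density theta k i (Z k i ord0).
Proof.
move=> ZX; rewrite /aug_likelihood /observed_density -big_split.
apply: eq_bigr => k _.
(* A mean uses parent columns only, and these differ from [ord0], so [Z] and [X] agree there; this
   includes the mean of [ord0] itself. *)
have mean0 j : node_mean L (Z k) j = node_mean L (X k) j.
  rewrite /node_mean (@eq_cols_in _ _ _ _ (X k))// => i l; rewrite inE => dlj.
  by apply: ZX; apply: contraTneq dlj => ->; exact: latent_childless.
(* Node [ord0] is split off and placed beside the cell indicators, to be merged with them row by
   row. *)
rewrite [X in X * _](bigD1 ord0 isT) -mulrA [LHS]mulrCA /=.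
apply: (congr2 *%R).
  apply: eq_bigr => j j0; rewrite mean0; congr mvnormal_pdf.
  by apply/matrixP => i l; rewrite [LHS]mxE [RHS]mxE ZX.
rewrite mean0 mvnormal_pdf_scalar// -big_split; apply: eq_bigr => i _.
by rewrite /latent_density [col _ _ _ _]mxE.
Qed.

Lemma integral_latent_density theta k :
  (\int[lebesgue_tuple (n k)]_x
     (\prod_(i < n k) latent_density theta k i (tnth x i))%:E)%E =
  (\prod_(i < n k) Psi (y k i) theta (latent_mean k i) (D ord0 ord0))%:E.
Proof.
apply: ge0_integral_lebesgue_tuple_prod => i.
- exact: measurable_normal_cell.
- by move=> x; rewrite mulr_ge0 ?ler0n// ltW// normal_density_gt0.
- exact: integral_normal_cell.
Qed.

Lemma integral_aug_likelihood theta :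
  (\int[lebesgue_tuple (n false) \x lebesgue_tuple (n true)]_x
     (aug_likelihood D L y theta
       (fun k => row_mx (latent_cols x k) (col' ord0 (X k))))%:E)%E =
  (observed_density *
   \prod_(k : bool) \prod_(i < n k)
     Psi (y k i) theta (latent_mean k i) (D ord0 ord0))%:E.
Proof.
pose F k (x : (n k).-tuple (measurableTypeR R)) : R :=
  \prod_(i < n k) latent_density theta k i (tnth x i).
have F0 k x : 0 <= F k x.
  apply: prodr_ge0 => i _.
  by rewrite mulr_ge0 ?ler0n// ltW// normal_density_gt0.
have mF k : measurable_fun setT (F k).
  by apply: measurable_tuple_prod => i; exact: measurable_normal_cell.
transitivity (\int[lebesgue_tuple (n false) \x lebesgue_tuple (n true)]_z
    (observed_density * F false z.1 * F true z.2)%:E)%E.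
  apply: eq_integral => z _; congr EFin.
  rewrite aug_likelihood_latent; last by move=> k i j; exact: row_mx_col'_neq0.
  (* [big_bool] lists [true] first, whereas the product measure starts with group [false]. *)
  rewrite big_bool -mulrA; congr (_ * _); rewrite mulrC; congr (_ * _);
    by apply: eq_bigr => i _; rewrite row_mx_col'0 mxE.
rewrite big_bool [X in _ * X]mulrC mulrA.
(* The constant is absorbed into the factor of the first group. *)
apply: (ge0_integral_prodM _ _ _ _ _ (lebesgue_tuple (n false))
  (lebesgue_tuple (n true)) (fun x => observed_density * F false x)
  (F true)) => //.
- by apply: measurable_funM; [exact: measurable_cst|exact: mF].
- exact: mF.
- by move=> x; rewrite mulr_ge0// ltW// observed_density_gt0.
- under eq_integral do rewrite EFinM.
  rewrite ge0_integralZl//=.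
  + by rewrite integral_latent_density.
  + apply/measurable_EFinP; exact: mF.
  + by move=> x _; rewrite lee_fin.
  + by rewrite lee_fin ltW// observed_density_gt0.
- exact: integral_latent_density.
Qed.

End marginal.

(** * Posterior and acceptance probability *)

Theorem mainTheorem5 (R : realType) (q : nat) (n : bool -> nat)
  (dag : bool -> rel 'I_q.+1)
  (dag_acyclic : forall k, acyclic (dag k))
  (latent_childless : forall k j, ~~ dag k ord0 j)
  (D : 'M[R]_q.+1) (D_diag : is_diag_mx D)
  (D_latent : D ord0 ord0 = 1) (D_pos : forall j, 0 < D j j)
  (L : forall (k : bool) (j : 'I_q.+1), 'cV[R]_#|parents (dag k) j|)
  (y : forall k : bool, 'I_(n k) -> bool)
  (X : forall k : bool, 'M[R]_(n k, q.+1))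
  (prior : R -> R)
  (prior_flat : propto (fun theta => (prior theta)%:E) (fun=> 1%E))
  (post : R -> \bar R)
  (post_def : propto post
     (posterior_kernel D L y prior (fun k => col' ord0 (X k)))) :
  propto post (fun theta =>
    (\prod_(k : bool) \prod_(i < n k)
       Psi (y k i) theta
         (- (row i (cols_in (X k) (parents (dag k) ord0)) *m L k ord0)
              ord0 ord0) 1)%:E)
  /\
  (forall (v0 : R), 0 < v0 -> forall theta theta' : R,
    mh_acceptance (fun t => fine (post t))
      (fun t' t => normal_density t v0 t') theta theta' =
    Num.min 1
      ((\prod_(k : bool)
          ((\prod_(i < n k)
              Psi (y k i) theta'
                (- (row i (cols_in (X k) (parents (dag k) ord0)) *m L k ord0)
                     ord0 ord0) 1) /
           (\prod_(i < n k)
              Psi (y k i) theta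
                (- (row i (cols_in (X k) (parents (dag k) ord0)) *m L k ord0)
                     ord0 ord0) 1))) *
       (normal_density theta' v0 theta / normal_density theta v0 theta'))).
Proof.
pose ell theta : R := \prod_(k : bool) \prod_(i < n k) Psi (y k i) theta
  (- (row i (cols_in (X k) (parents (dag k) ord0)) *m L k ord0) ord0 ord0) 1.
have meanE k i : node_mean L (X k) ord0 i ord0 =
    - (row i (cols_in (X k) (parents (dag k) ord0)) *m L k ord0) ord0 ord0.
  by rewrite mxE -row_mul [in RHS]mxE.
have [c [c0 postE]] : propto post (fun theta => (ell theta)%:E).
  have [b [b0 bE]] := post_def; have [p [p0 pE]] := prior_flat.
  (* The factors come from the normalization of [post], the observed nodes and the flat prior. *)
  exists (b * (observed_density R q n dag D L X * p)); split.
    by rewrite !mulr_gt0// observed_density_gt0.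
  move=> theta; rewrite bE /posterior_kernel integral_aug_likelihood// pE mule1.
  rewrite -!EFinM; congr EFin.
  rewrite [X in _ * X]mulrAC [LHS]mulrA; apply: (congr1 ( *%R _)).
  by apply: eq_bigr => k _; apply: eq_bigr => i _; rewrite D_latent meanE.
split; first by exists c.
(* By [postE], [post] is finite, so [fine] returns [c * ell]. *)
move=> v0 v0_gt0 theta theta'; rewrite /mh_acceptance !postE /=.
rewrite big_split/= prodfV -/(ell theta) -/(ell theta'); congr Num.min.
(* Regrouping isolates [c / c], which is 1 because [c] is positive. *)
by rewrite -[LHS]mulf_div -[X in X * _ = _]mulf_div divff ?mul1r ?gt_eqF.
Qed.
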